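(* Let $p$ be a prime and let $G$ be a finite nonabelian $p$-group with cyclic center. If $\operatorname{cd}(G)=\{1,p^{a}\}$ or $\operatorname{cd}(G)=\{1,p,p^{a}\}$ for some integer $a\geq 1$, then $\delta(G)=p^{a}$. Further, $\delta(G)=p$ if and only if $\operatorname{cd}(G)=\{1,p\}$.
   Context: Representations and characters are over $\mathbb{C}$. $\delta(G)$ is the minimal degree of a faithful complex representation of the finite group $G$. $\operatorname{cd}(G)$ is the set of degrees of all irreducible complex characters of $G$. *)

(* Defs.v *)
From mathcomp Require Import all_boot all_order all_algebra.
From mathcomp Require Import all_fingroup all_solvable.
From mathcomp Require Import mxrepresentation.
From mathcomp Require Import boolp classical_sets reals complex.

Set Implicit Arguments.
Unset Strict Implicit.
Unset Printing Implicit Defensive.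

Import GroupScope GRing.Theory.
Local Open Scope ring_scope.
Local Open Scope complex_scope.

(* For R : realType, R[i] is the field of complex numbers.  The 'CF(G) and
   irr G of the character library take values in algC, hence the definitions
   below, which work over R[i] itself. *)

Definition has_faithful_repr (R : realType) (gT : finGroupType)
    (G : {group gT}) (n : nat) : Prop :=
  exists rG : mx_representation R[i] G n, mx_faithful rG.

(* The regular representation is faithful, so the minimum exists. *)
Lemma ex_faithful_repr (R : realType) (gT : finGroupType) (G : {group gT}) :
  exists n, `[< has_faithful_repr R G n >].
Proof.
exists #|G|; apply/asboolP; exists (regular_repr R[i] G).
exact: regular_mx_faithful.
Qed.

Definition delta (R : realType) (gT : finGroupType) (G : {group gT}) : nat :=
  ex_minn (ex_faithful_repr R G).

(* Only the values of chi on G are constrained. *)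
Definition irr_character (R : realType) (gT : finGroupType) (G : {group gT})
    (chi : gT -> R[i]) : Prop :=
  exists (n : nat) (rG : mx_representation R[i] G n),
    mx_irreducible rG /\ {in G, forall x, chi x = \tr (rG x)}.

Definition cd (R : realType) (gT : finGroupType) (G : {group gT}) : set nat :=
  [set n : nat | exists2 chi : gT -> R[i],
     irr_character G chi & chi 1%g = n%:R]%classic.

(* Main.v *)
Require Import Defs.
From mathcomp Require Import boolp classical_sets reals complex.
From mathcomp Require Import all_boot all_order all_algebra.
From mathcomp Require Import all_fingroup all_solvable.
From mathcomp Require Import mxrepresentation.

(** Write [F] for an algebraically closed field, in the end the complex numbers.

    A nontrivial normal subgroup of a [p]-group [G] meets the center, so when
    the center is cyclic it contains the unique central subgroup [Z] of order
    [p].  Hence a representation on which [Z] acts nontrivially is faithful.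
    By Maschke's theorem some irreducible constituent of a faithful
    representation has this property, and so the minimal degree of a faithful
    representation is attained by an irreducible one ([faithful_irr_sub],
    [delta_irr]).  In particular [delta R G] lies in [cd R G], and it is not
    [1] since a faithful representation of degree [1] makes [G] abelian.

    It remains to see that [delta R G = p] forces [cd R G] to be [{1, p}]:
    this excludes the value [p] in the case [{1, p, p ^ a}] unless
    [p ^ a = p], and it is the hard half of the equivalence.  The link
    between the two sides is an abelian normal subgroup [A] of index [p].

    - A faithful irreducible representation of degree [p] produces [A]
      ([faithful_irr_prime_degree_abelian_index]).  Restrict it to a
      self-centralizing abelian normal subgroup.  By Clifford's theorem the
      homogeneous components are permuted transitively and have equal rank,
      so there are [1] or [p] of them.  A single one would make the subgroup
      act by scalars, hence be central, hence equal to [G].  So there are [p]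
      lines; the stabilizer of one line has index [p], is therefore normal and
      stabilizes all the lines, so it acts diagonally and is abelian.
    - If [A] exists then every irreducible representation has degree [1] or
      [p] ([irr_degree_abelian_prime_index]).  The stabilizer of a homogeneous
      component of the restriction to [A] lies between [A] and [G], so it is
      [A] or [G].  If it is [A], a component is an irreducible module of the
      abelian group [A], that is a line, and there are [p] of them.  If it is
      [G], then [A] acts by scalars, the image of [G] is central-by-cyclic,
      hence abelian, and the degree is [1]. *)

Set Implicit Arguments.
Unset Strict Implicit.

(** * Restriction to an abelian normal subgroup *)

Lemma simple_abelian_rank1 (F : closedFieldType) (gT : finGroupType)
    (A : {group gT}) (n : nat) (rA : mx_representation F A n) (M : 'M[F]_n) :
  abelian A -> mxsimple rA M -> \rank M = 1%N.
Proof.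
exact: (mxsimple_abelian_linear (@group_closure_closed_field F gT A)).
Qed.

Lemma irr_abelian_linear (F : closedFieldType) (gT : finGroupType)
    (A : {group gT}) (n : nat) (rA : mx_representation F A n) :
  abelian A -> mx_irreducible rA -> n = 1%N.
Proof.
move=> abA irrA.
exact: (mx_irr_abelian_linear (@group_closure_closed_field F gT A) irrA abA).
Qed.

(** An element of [A] acts by a scalar on the simple module [M], which is a
    line, and by the same scalar on every isomorphic copy of [M]. *)
Lemma component_eigenspace (F : closedFieldType) (gT : finGroupType)
    (A : {group gT}) (n : nat) (rA : mx_representation F A n)
    (M : 'M[F]_n) (x : gT) :
  (abelian A)%g -> mxsimple rA M -> (x \in A)%g ->
  exists a : F, (component_mx rA M <= eigenspace (rA x) a)%MS.
Proof.
move=> abA simM Ax; have [modM nzM _] := simM.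
have rankM := simple_abelian_rank1 abA simM.
set v := nz_row M.
have sMv : (M <= v)%MS.
  rewrite -(geq_leqif (mxrank_leqif_sup (nz_row_sub M))) rankM.
  by rewrite rank_rV nz_row_eq0 nzM.
have [a vx] : exists a, (v *m rA x)%R = (a *: v)%R.
  apply/sub_rVP; apply: submx_trans sMv.
  exact: submx_trans (submxMr _ (nz_row_sub M)) (mxmoduleP modM x Ax).
have{vx} Mx : (M *m rA x)%R = (a *: M)%R.
  case/submxP: sMv => D ->.
  by rewrite -mulmxA vx -scalemxAr.
exists a; have [I [U isoU ->]] := component_mx_def simM.
apply/sumsmx_subP=> i _; have [f _ homf defU] := isoU i.
rewrite -defU; apply/eigenspaceP.
by rewrite -(hom_mxP homf) // Mx -scalemxAl.
Qed.

Lemma one_component_rcenter (F : closedFieldType) (gT : finGroupType)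
    (G A : {group gT}) (nsAG : (A <| G)%g) (n : nat)
    (rG : mx_representation F G n)
    (sA : socleType (subg_repr rG (normal_sub nsAG))) :
  mx_irreducible rG -> (abelian A)%g -> #|sA| = 1%N -> A \subset rcenter rG.
Proof.
move=> irrG abA sA1; apply/subsetP=> x Ax.
have /fintype1[W allW] := sA1.
rewrite inE (subsetP (normal_sub nsAG)) //=.
have [a sWa] := component_eigenspace abA (socle_simple W) Ax.
apply/is_scalar_mxP; exists a.
have /eigenspaceP : (1%:M%R <= eigenspace (rG x) a)%MS.
  rewrite -(Clifford_Socle1 irrG sA).
  by apply/sumsmx_subP=> W' _; rewrite (allW W').
by rewrite mul1mx => ->; rewrite scale_scalar_mx GRing.mulr1.
Qed.

(** The scalars are central in the image of [G], so that image is
    central-by-cyclic and hence abelian. *)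
Lemma cyclic_rcenter_quotient_linear (F : closedFieldType) (gT : finGroupType)
    (G A : {group gT}) (n : nat) (rG : mx_representation F G n) :
  mx_irreducible rG -> (A <| G)%g -> A \subset rcenter rG ->
  cyclic (G / A)%g -> n = 1%N.
Proof.
move=> irrG nsAG sAC cycGA.
(* The argument takes place in G / rker rG, on which rG induces a faithful
   irreducible representation. *)
have nsCG := rcenter_normal rG; have nsKG := rker_normal rG.
have sKC : rker rG \subset rcenter rG.
  apply/subsetP=> x /rkerP[Gx rx1].
  by rewrite inE Gx rx1; apply/is_scalar_mxP; exists 1%R.
have cycGC : cyclic (G / rcenter rG)%g.
  by rewrite -(isog_cyclic (third_isog sAC nsAG nsCG)) quotient_cyclic.
have abGK : abelian (G / rker rG)%g.
  apply: (@cyclic_factor_abelian _ (rcenter rG / rker rG)%G); last first.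
    by rewrite (isog_cyclic (third_isog sKC nsKG nsCG)).
  rewrite subsetI (quotientS _ (normal_sub nsCG)); apply: quotient_cents2r.
  rewrite gen_subG; apply/subsetP=> _ /imset2P[x y Cx Gy ->].
  move: Cx; rewrite inE => /andP[Gx /is_scalar_mxP[a rx]].
  apply/rkerP; split; first by rewrite groupR.
  have rV z : z \in G -> (rG z^-1%g *m rG z = 1%:M)%R.
    by move=> Gz; rewrite -repr_mxM ?groupV // mulVg repr_mx1.
  rewrite commgEl conjgE !repr_mxM ?groupV ?groupM ?groupV //.
  by rewrite rx -scalar_mxC (mulmxA (rG y^-1%g)) rV // mul1mx -rx rV.
have /quo_mx_irr irrGK := irrG.
apply: (irr_abelian_linear abGK).
exact: irrGK (subxx (rker rG)) (rker_norm rG).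
Qed.

(** This is the orbit-stabilizer formula for the Clifford action, in which
    the stabilizer of a homogeneous component is its setwise stabilizer as a
    subspace. *)
Lemma card_components_index (F : closedFieldType) (gT : finGroupType)
    (G A : {group gT}) (nsAG : (A <| G)%g) (n : nat)
    (rG : mx_representation F G n)
    (sA : socleType (subg_repr rG (normal_sub nsAG))) (W : sA) :
  mx_irreducible rG ->
  #|sA| = #|G : rstabs rG W|%g /\ A \subset rstabs rG W.
Proof.
move=> irrG; have trG := Clifford_atrans irrG sA.
split.
  rewrite -cardsT -(atransPin (subxx G) trG (in_setT W)) card_orbit_in //.
  by rewrite Clifford_astab1 (setIidPr (rstabs_sub _ _)).
rewrite -(Clifford_astab1 W).
apply: subset_trans (subset_trans (joing_subl _ _) (Clifford_astab sA)) _.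
exact: astabS (subsetT _).
Qed.

(** * Abelian subgroups of prime index *)

(** The number of homogeneous components for [A] divides the prime [#|G : A|].
    One component means that [A] is scalar and the degree is [1].  Otherwise
    [A] is the stabilizer of each component; since a component is simple under
    its stabilizer, it is a line. *)
Lemma irr_degree_abelian_prime_index (F : closedFieldType)
    (gT : finGroupType) (G A : {group gT}) (n : nat)
    (rG : mx_representation F G n) :
    (A <| G)%g -> abelian A -> prime #|G : A|%g -> mx_irreducible rG ->
  n = 1%N \/ n = #|G : A|%g.
Proof.
move=> nsAG abA prA irrG.
pose sA := DecSocleType (subg_repr rG (normal_sub nsAG)).
have [W _ _] := imsetP (Clifford_atrans irrG sA).
have [cardS sAT] := card_components_index W irrG.
have defn := Clifford_rank_components irrG W.
have [s1 | s_n1] := eqVneq #|sA| 1%N.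
  left; apply: (cyclic_rcenter_quotient_linear irrG nsAG) => //.
    exact: one_component_rcenter s1.
  by rewrite prime_cyclic // card_quotient ?normal_norm.
have sTG := rstabs_sub rG W.
have sp : #|sA| = #|G : A|%g.
  by apply/(prime_nt_dvdP prA s_n1); rewrite cardS indexgS.
have defT : rstabs rG W = A.
  apply/eqP; rewrite eqEsubset sAT andbT -indexg_eq1.
  rewrite -(eqn_pmul2l (prime_gt0 prA)) muln1 -[X in X * _]sp cardS.
  by rewrite Lagrange_index.
right; rewrite -defn sp.
rewrite (simple_abelian_rank1 _ (Clifford_rstabs_simple irrG W)) ?muln1 //.
by rewrite /= defT.
Qed.

(** A maximal abelian normal subgroup [A] is its own centralizer, so it cannot
    act by scalars unless [G] is abelian.  Hence the representation is a sum
    of [p] lines permuted transitively by [G], and the subgroup wanted is the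
    stabilizer of one of them, which may be larger than [A]. *)
Lemma faithful_irr_prime_degree_abelian_index (F : closedFieldType)
    (gT : finGroupType) (G : {group gT}) (p : nat)
    (rG : mx_representation F G p) :
    prime p -> (p.-group G)%g -> mx_irreducible rG -> mx_faithful rG ->
  exists A : {group gT}, [/\ (A <| G)%g, abelian A & #|G : A|%g = p].
Proof.
move=> pr_p pG irrG ffulG.
have nabG : ~~ abelian G.
  apply: contraL pr_p => abG.
  by rewrite (irr_abelian_linear abG irrG).
have [A maxA _] :
    {A : {group gT} | [max A | A <| G & abelian A]%g & 1%G \subset A}.
  by apply: maxgroup_exists; rewrite normal1 abelian1.
have /SCN_P[nsAG defCA] := max_SCN pG maxA.
have abA : abelian A by case/maxgroupp/andP: maxA.
pose sA := DecSocleType (subg_repr rG (normal_sub nsAG)).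
have trG := Clifford_atrans irrG sA.
have [W _ _] := imsetP trG.
have [cardS sAT] := card_components_index W irrG.
have defp := Clifford_rank_components irrG W.
have s_n1 : #|sA| != 1%N.
  apply: contra nabG => /eqP s1; apply: (abelianS _ abA).
  rewrite -defCA subsetI subxx /= centsC; apply/subsetP=> x Ax.
  have := subsetP (one_component_rcenter irrG abA s1) x Ax.
  rewrite inE => /andP[Gx /is_scalar_mxP[a rx]].
  apply/centP=> y Gy; apply: (mx_faithful_inj ffulG); rewrite ?groupM //.
  by rewrite !repr_mxM // rx scalar_mxC.
have sp : #|sA| = p.
  by apply/(prime_nt_dvdP pr_p s_n1); rewrite -[X in _ %| X]defp dvdn_mulr.
have rankW (W' : sA) : \rank W' = 1%N.
  apply/eqP; rewrite -(eqn_pmul2l (prime_gt0 pr_p)) muln1 -{1}sp.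
  by rewrite (Clifford_rank_components irrG).
pose T := [group of rstabs rG W].
have iT : #|G : T|%g = p by rewrite -cardS.
have nsTG : (T <| G)%g.
  by apply: (p_maximal_normal pG); rewrite p_index_maximal ?rstabs_sub ?iT.
exists T; split=> //.
have sTG := normal_sub nsTG.
pose rT := subg_repr rG sTG.
(* T is normal, hence the stabilizer of every G-translate of W as well. *)
have modT (W' : sA) : mxmodule rT W'.
  have : W' \in orbit (Clifford_action sA) G W.
    by rewrite (atransPin (subxx G) trG) inE.
  case/orbitP=> g Gg <-.
  apply/mxmoduleP=> t Tt.
  have Gt := subsetP sTG t Tt.
  rewrite (eqmxMr _ (val_Clifford_act W Gg)) (val_Clifford_act W Gg).
  rewrite /= -mulmxA -repr_mxM // conjgCV repr_mxM ?groupJ ?groupV // mulmxA.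
  apply: submxMr.
  have : (t ^ g^-1 \in T)%g.
    by rewrite memJ_norm ?groupV // (subsetP (normal_norm nsTG)).
  by rewrite inE => /andP[].
(* Each line W' is a representation of T of degree 1, so the derived subgroup
   of T acts trivially on all of them, and thus lies in the kernel of rG. *)
apply/commG1P/trivgP; apply: subset_trans ffulG.
apply/subsetP=> x T'x.
have Gx : x \in G by apply: (subsetP sTG); apply: (subsetP (der_sub 1 T)).
apply/rkerP; split=> //.
suff /eigenspaceP : (1%:M%R <= eigenspace (rG x) 1%R)%MS.
  by rewrite mul1mx GRing.scale1r.
rewrite -(Clifford_Socle1 irrG sA); apply/sumsmx_subP=> W' _.
apply/eigenspaceP; rewrite GRing.scale1r.
have : x \in rker (submod_repr (modT W')).
  by apply: (subsetP (rker_linear _ (rankW W'))).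
by rewrite rker_submod inE => /andP[_ /eqP].
Qed.

(** * Faithful irreducible constituents and character degrees *)

(** Every nontrivial normal subgroup contains the subgroup [Z] of order [p] of
    the cyclic center.  A simple submodule not fixed by [Z], which exists by
    complete reducibility, is therefore faithful. *)
Lemma faithful_irr_sub (F : closedFieldType) (gT : finGroupType)
    (G : {group gT}) (p n : nat) (rG : mx_representation F G n) :
    ([pchar F]%R^').-group%g G -> p.-group%g G -> G :!=: 1%g ->
    cyclic 'Z(G)%g -> mx_faithful rG ->
  exists d (rH : mx_representation F G d),
    [/\ (d <= n)%N, mx_irreducible rH & mx_faithful rH].
Proof.
move=> F'G pG ntG cycZ ffulG; have nilG := pgroup_nil pG.
have [p_pr _ _] := pgroup_pdiv pG ntG.
pose Z := 'Ohm_1('Z(G))%G.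
have ntZ : 'Z(G)%g != 1%g by rewrite center_nil_eq1.
have oZ : #|Z| = p.
  by apply: Ohm1_cyclic_pgroup_prime => //; apply: pgroupS (center_sub G) pG.
have sZ_K (K : {group gT}) : (K <| G)%g -> K :!=: 1%g -> Z \subset K.
  move=> nsKG ntK; apply: prime_meetG; rewrite ?oZ // setIC.
  by rewrite meet_Ohm1 // meet_center_nil.
have [I U V simU defU _] :=
  dec_mx_reducible_semisimple (mxmodule1 rG) (mx_Maschke_pchar rG F'G).
have sZG : Z \subset G.
  exact: subset_trans (Ohm_sub 1 _) (center_sub G).
have [i nfixU] : exists i, ~~ (Z \subset rstab rG (U i)).
  apply/existsP; rewrite -negb_forall; apply/negP=> /forallP fixU.
  have /trivGP Z1 : Z \subset [1]%g.
    apply: subset_trans ffulG; apply/subsetP=> z Zz.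
    apply/rkerP; split; first exact: (subsetP sZG).
    suff /eigenspaceP : (1%:M%R <= eigenspace (rG z) 1%R)%MS.
      by rewrite mul1mx GRing.scale1r.
    rewrite -defU; apply/sumsmx_subP=> j _; apply/eigenspaceP.
    rewrite GRing.scale1r.
    by have := subsetP (fixU j) z Zz; rewrite inE => /andP[_ /eqP].
  by move: p_pr; rewrite -oZ Z1 cards1.
have [modU _ _] := simU i.
exists (\rank (U i)), (submod_repr modU); split.
- exact: rank_leq_row.
- by apply/(submod_mx_irr modU).
have [K1 | ntK] := eqVneq (rker (submod_repr modU)) 1%g.
  by rewrite /mx_faithful K1.
case/negP: nfixU; rewrite -(rker_submod modU).
exact: sZ_K (rker_normal _) ntK.
Qed.

Lemma pchar_complex_group (R : realType) (gT : finGroupType)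
    (G : {group gT}) : ([pchar R[i]]%R^').-group%g G.
Proof.
by apply/pgroupP=> q _ _; rewrite inE /= Num.Theory.pchar_num.
Qed.

(** In characteristic [0] the value of a character at [1] determines the
    degree. *)
Lemma cdP (R : realType) (gT : finGroupType) (G : {group gT}) (n : nat) :
  cd R G n <-> exists rG : mx_representation R[i] G n, mx_irreducible rG.
Proof.
split=> [[chi [m [rG [irrG chiE]]] chi1] | [rG irrG]].
  suff <- : m = n by exists rG.
  move: chi1; rewrite chiE ?group1 // repr_mx1 mxtrace1 => /eqP.
  by rewrite Num.Theory.eqr_nat => /eqP.
exists (fun x => \tr (rG x))%R; first by exists n, rG.
by rewrite repr_mx1 mxtrace1.
Qed.

Lemma cd1 (R : realType) (gT : finGroupType) (G : {group gT}) :
  cd R G 1%N.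
Proof.
have one_repr : mx_repr G (fun=> 1%:M%R : 'M[R[i]]_1).
  by split=> // x y _ _; rewrite mulmx1.
apply/cdP; exists (MxRepresentation one_repr).
by apply: mx_abs_irrW; apply: linear_mx_abs_irr.
Qed.

(** A faithful irreducible constituent of a faithful representation of minimal
    degree cannot have smaller degree. *)
Lemma delta_irr (R : realType) (gT : finGroupType) (G : {group gT})
    (p : nat) :
    p.-group%g G -> G :!=: 1%g -> cyclic 'Z(G)%g ->
  exists2 rG : mx_representation R[i] G (delta R G),
    mx_irreducible rG & mx_faithful rG.
Proof.
move=> pG ntG cycZ; rewrite /delta.
case: ex_minnP => n /asboolP[rG ffulG] min_n.
have [d [rH [led irrH ffulH]]] :=
  faithful_irr_sub (pchar_complex_group R G) pG ntG cycZ ffulG.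
suff <- : d = n by exists rH.
by apply/eqP; rewrite eqn_leq led min_n //; apply/asboolP; exists rH.
Qed.

Lemma faithful_prime_degree_cd (R : realType) (gT : finGroupType)
    (G : {group gT}) (p n : nat) (rG : mx_representation R[i] G p) :
    prime p -> p.-group%g G -> mx_irreducible rG -> mx_faithful rG ->
  cd R G n -> n = 1%N \/ n = p.
Proof.
move=> p_pr pG irrG ffulG /cdP[rH irrH].
have [A [nsAG abA iA]] :=
  faithful_irr_prime_degree_abelian_index p_pr pG irrG ffulG.
by have := irr_degree_abelian_prime_index nsAG abA _ irrH; rewrite iA; apply.
Qed.

Unset Implicit Arguments.

Theorem theorem1p2 (R : realType) (gT : finGroupType) (G : {group gT})
    (p : nat) (p_prime : prime p) (pG : (p.-group G)%g)
    (nabG : ~~ (abelian G)%g) (cycZ : cyclic ('Z(G))%g) :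
  (forall a : nat, (1 <= a)%N ->
     cd R G = [set 1%N; (p ^ a)%N]%classic \/
     cd R G = [set 1%N; p; (p ^ a)%N]%classic ->
     delta R G = (p ^ a)%N) /\
  (delta R G = p <-> cd R G = [set 1%N; p]%classic).
Proof.
have ntG : G :!=: 1%g by apply: contraNneq nabG => ->; apply: abelian1.
have [rG irrG ffulG] := delta_irr R pG ntG cycZ.
have cd_delta : cd R G (delta R G) by apply/cdP; exists rG.
have delta_n1 : delta R G <> 1%N.
  move=> d1; case/negP: nabG; apply/commG1P/trivgP.
  exact: fintype.subset_trans (rker_linear rG d1) ffulG.
have delta_p n : delta R G = p -> cd R G n -> n = 1%N \/ n = p.
  move=> dp; move: rG irrG ffulG; rewrite dp => rG irrG ffulG.
  exact: faithful_prime_degree_cd irrG ffulG.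
have delta_pa a : (1 <= a)%N ->
    cd R G = [set 1%N; (p ^ a)%N]%classic \/
    cd R G = [set 1%N; p; (p ^ a)%N]%classic ->
  delta R G = (p ^ a)%N.
  move=> a_gt0 cdG.
  have cd_pa : cd R G (p ^ a)%N by case: cdG => ->; right.
  have pa_n1 : (p ^ a)%N <> 1%N.
    have : (1 ^ a < p ^ a)%N by rewrite ltn_exp2r ?prime_gt1.
    by rewrite exp1n => lt1pa pa1; rewrite pa1 in lt1pa.
  have [dp | //] : delta R G = p \/ delta R G = (p ^ a)%N.
    move: cd_delta; case: cdG => ->; first by case=> [/delta_n1 | ]; auto.
    by case=> [[/delta_n1 | ] | ]; auto.
  by case: (delta_p _ dp cd_pa) => [/pa_n1 | ->].
split; first exact: delta_pa.
split=> [dp | cdG]; last by rewrite (delta_pa 1%N) ?expn1 //; left.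
apply/predeqP=> n; split=> [/(delta_p _ dp)[] -> | [] ->].
- by left.
- by right.
- exact: cd1.
- by rewrite -[p in cd _ _ p]dp.
Qed.
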